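(* Let $ABC$ be a triangle in the Euclidean plane, let $D$ be the midpoint of side $BC$, and let $P$ be any point on the median $AD$ lying inside $\triangle ABC$. Let lines $BP$ and $CP$ meet the sides $CA$ and $AB$ at $E$ and $F$, respectively, so that the cevians $AD$, $BE$, $CF$ through $P$ divide $\triangle ABC$ into the six smaller triangles $T_1=PBD$, $T_2=PDC$, $T_3=PCE$, $T_4=PEA$, $T_5=PAF$, $T_6=PFB$. Let $O_i$ be the circumcenter of $T_i$ for $i=1,\dots,6$. Then (a) the points $O_1$, $O_2$, $O_3$, and $O_6$ lie on a circle, and (b) the points $O_3$, $O_4$, $O_5$, and $O_6$ lie on a circle.
   Context: A cevian through a point is a segment from a vertex of the triangle through that point to the opposite side. A median is a segment joining a vertex to the midpoint of the opposite side. *)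

(* Defs.v *)
From mathcomp Require Import all_boot all_order all_algebra reals.

Set Implicit Arguments.
Unset Strict Implicit.
Unset Printing Implicit Defensive.

Import Order.TTheory GRing.Theory Num.Theory.
Local Open Scope ring_scope.

(* Plane Euclidean geometry in coordinates: points are row vectors of R^2.
   The norm that MathComp-Analysis puts on matrices is the sup norm, so the
   Euclidean distance is defined here. *)

Section EuclideanPlane.
Variable R : realType.

Definition plane := 'rV[R]_2.

Implicit Types (X Y Z W O : plane) (r : R).

Definition dist X Y : R := Num.sqrt (\sum_(i < 2) (X 0 i - Y 0 i) ^+ 2).

Definition midpoint X Y : plane := 2^-1 *: (X + Y).

Definition in_segment X Y Z : Prop :=
  exists t : R, 0 <= t <= 1 /\ Z = (1 - t) *: X + t *: Y.

(* For X != Y, Z is on the line XY. *)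
Definition on_line X Y Z : Prop :=
  exists t : R, Z = (1 - t) *: X + t *: Y.

Definition collinear X Y Z : Prop :=
  exists U V : plane, [/\ U != V, on_line U V X, on_line U V Y & on_line U V Z].

Definition triangle X Y Z : Prop := ~ collinear X Y Z.

(* The open triangle: the points with positive barycentric coordinates. *)
Definition inside_triangle X Y Z W : Prop :=
  exists a b c : R, [/\ 0 < a, 0 < b & 0 < c] /\
    a + b + c = 1 /\ W = a *: X + b *: Y + c *: Z.

Definition on_circle O r X : Prop := dist O X = r.

(* For a nondegenerate triangle XYZ such an O exists and is unique. *)
Definition is_circumcenter X Y Z O : Prop :=
  exists r, 0 < r /\ [/\ on_circle O r X, on_circle O r Y & on_circle O r Z].

Definition concyclic X Y Z W : Prop :=
  exists O r, 0 < r /\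
    [/\ on_circle O r X, on_circle O r Y, on_circle O r Z & on_circle O r W].

End EuclideanPlane.

(* Main.v *)
(* With P as origin and b, c the vectors PB, PC, the cevian hypotheses read
   PE = -e b, PF = -e c, PA = -k (b + c), 2 PD = b + c.  Each circumcenter O is
   then determined by the two numbers (2 PO.b, 2 PO.c), and in each of the two
   quadruples two centers lie on a perpendicular to b and the other two on a
   perpendicular to c.  Both claims thus follow from the converse of the
   intersecting secants theorem at the common point of these perpendiculars. *)
Require Import Defs.
From mathcomp Require Import all_boot all_order all_algebra reals.
From mathcomp Require Import ring lra.

Set Implicit Arguments.
Unset Strict Implicit.
Unset Printing Implicit Defensive.

Import Order.TTheory GRing.Theory Num.Theory.
Local Open Scope ring_scope.

Section Plane.
Variable R : realType.
Implicit Types (u v w : plane R) (X Y Z O P : plane R) (x y s t e k : R).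

(** * Dot and cross products, distances and collinearity in coordinates *)

Definition dot u v : R := u 0 0 * v 0 0 + u 0 1 * v 0 1.
Definition cross u v : R := u 0 0 * v 0 1 - u 0 1 * v 0 0.

Lemma plane_eqP u v : u 0 0 = v 0 0 -> u 0 1 = v 0 1 -> u = v.
Proof.
move=> h0 h1; apply/rowP => i.
case: i => [[|[|//]] hi]; [move: h0 | move: h1]; congr (_ = _); congr (_ _ _);
  exact/val_inj.
Qed.

Lemma plane_neqP u v : u != v -> u 0 0 - v 0 0 != 0 \/ u 0 1 - v 0 1 != 0.
Proof.
move=> uv; have [/eqP h0|] := boolP (u 0 0 - v 0 0 == 0); last by left.
right; apply: contraNneq uv => /eqP h1; apply/eqP.
by apply: plane_eqP; apply/eqP; rewrite -subr_eq0 ?h0.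
Qed.

Lemma dot_gt0 u v : u != v -> 0 < dot (u - v) (u - v).
Proof.
rewrite /dot !mxE => /plane_neqP[] h.
  by rewrite -!expr2 ltr_pwDl ?sqr_ge0 // lt_neqAle eq_sym expf_neq0 ?sqr_ge0.
by rewrite -!expr2 ltr_wpDl ?sqr_ge0 // lt_neqAle eq_sym expf_neq0 ?sqr_ge0.
Qed.

Lemma distE X Y : dist X Y = Num.sqrt (dot (X - Y) (X - Y)).
Proof.
rewrite /dist big_ord_recl big_ord1 /dot !mxE -!expr2.
by congr (Num.sqrt (_ + (X _ _ - Y _ _) ^+ 2)); exact/val_inj.
Qed.

Lemma dist_eq_dot O X Y :
  dist O X = dist O Y -> dot (O - X) (O - X) = dot (O - Y) (O - Y).
Proof.
have pos u : 0 <= dot u u by rewrite /dot -!expr2 addr_ge0 ?sqr_ge0.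
rewrite !distE => h.
by rewrite -(sqr_sqrtr (pos (O - X))) h sqr_sqrtr.
Qed.

(** Expanding both squared distances cancels [dot (O - P) (O - P)], and one factor [s] then divides
    out: this is the perpendicular bisector of [P] and [X], in terms of the direction [v]. *)
Lemma equidistant_shift O P X v s :
  s != 0 -> X - P = s *: v -> dist O P = dist O X ->
  2 * dot (O - P) v = s * dot v v.
Proof.
move=> s0 hX /dist_eq_dot; have -> : X = P + s *: v by rewrite -hX addrC subrK.
rewrite /dot !mxE => h; apply: (mulfI s0); lra.
Qed.

Lemma circumcenter_dot P X Y O v w s t :
  is_circumcenter P X Y O ->
  s != 0 -> X - P = s *: v -> t != 0 -> Y - P = t *: w ->
  2 * dot (O - P) v = s * dot v v /\ 2 * dot (O - P) w = t * dot w w.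
Proof.
move=> [r [_ [hP hX hY]]] s0 hs t0 ht.
by split; [apply: (equidistant_shift s0 hs)|apply: (equidistant_shift t0 ht)];
  rewrite hP.
Qed.

Lemma cross_eq0_collinear X Y Z : cross (Y - X) (Z - X) = 0 -> collinear X Y Z.
Proof.
have lineL U V : on_line U V U by exists 0; rewrite subr0 scale1r scale0r addr0.
have lineR U V : on_line U V V by exists 1; rewrite subrr scale1r scale0r add0r.
move=> h; have [XY|XY] := eqVneq Y X; last first.
  exists X, Y; split=> //; first by rewrite eq_sym.
  have d0 := dot_gt0 XY; have dn := lt0r_neq0 d0.
  (* The parameter of the orthogonal projection of [Z] onto the line [X Y]. *)
  exists (dot (Z - X) (Y - X) / dot (Y - X) (Y - X)).
  set t := _ / _.
  have tE : t * dot (Y - X) (Y - X) = dot (Z - X) (Y - X) by rewrite divfK.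
  apply: plane_eqP; rewrite !mxE; apply/eqP; rewrite -subr_eq0; apply/eqP;
    apply: (mulIf dn); rewrite mul0r.
    transitivity (dot (Y - X) (Y - X) * (Z 0 0 - X 0 0) -
      t * dot (Y - X) (Y - X) * (Y 0 0 - X 0 0)); first by ring.
    rewrite tE; transitivity (- (Y 0 1 - X 0 1) * cross (Y - X) (Z - X)).
      by rewrite /dot /cross !mxE; ring.
    by rewrite h mulr0.
  transitivity (dot (Y - X) (Y - X) * (Z 0 1 - X 0 1) -
    t * dot (Y - X) (Y - X) * (Y 0 1 - X 0 1)); first by ring.
  rewrite tE; transitivity ((Y 0 0 - X 0 0) * cross (Y - X) (Z - X)).
    by rewrite /dot /cross !mxE; ring.
  by rewrite h mulr0.
rewrite XY; have [XZ|XZ] := eqVneq Z X; last first.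
  by exists X, Z; split=> //; rewrite eq_sym.
rewrite XZ; exists X, (X + const_mx 1); split=> //.
apply/eqP => /(congr1 (fun u : plane R => u 0 0)); rewrite !mxE; lra.
Qed.

Lemma triangle_cross X Y Z : triangle X Y Z -> cross (Y - X) (Z - X) != 0.
Proof. by move=> h; apply/eqP => /cross_eq0_collinear. Qed.

(** Cramer's rule; it is used below to compare coefficients in a basis. *)
Lemma cross_free u v x y :
  cross u v != 0 -> x *: u + y *: v = 0 -> x = 0 /\ y = 0.
Proof.
rewrite /cross => uv h.
have h0 := congr1 (fun w : plane R => w 0 0) h.
have h1 := congr1 (fun w : plane R => w 0 1) h.
move: h0 h1; rewrite !mxE => h0 h1.
split; apply: (mulIf uv); rewrite mul0r.
  transitivity ((x * u 0 0 + y * v 0 0) * v 0 1 -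
                (x * u 0 1 + y * v 0 1) * v 0 0); first by ring.
  by rewrite h0 h1; ring.
transitivity ((x * u 0 1 + y * v 0 1) * u 0 0 -
              (x * u 0 0 + y * v 0 0) * u 0 1); first by ring.
by rewrite h0 h1; ring.
Qed.

Lemma on_line_sym U V X : on_line U V X -> on_line V U X.
Proof. by move=> [t ->]; exists (1 - t); rewrite subKr addrC. Qed.

Lemma in_segment_on_line U V X : in_segment U V X -> on_line U V X.
Proof. by move=> [t [_ ->]]; exists t. Qed.

(** * Converse of the intersecting secants theorem *)

(** The center [V + z] is chosen to project onto the midpoints of both chords. The squared distances
    to the four points are then [dot z z] minus [s1 * s2 * dot v v] or [t1 * t2 * dot w w], the two
    powers of [V]. *)
Lemma concyclic_secants_param V v w s1 s2 t1 t2 :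
  cross v w != 0 -> V + s1 *: v != V + t1 *: w ->
  s1 * s2 * dot v v = t1 * t2 * dot w w ->
  concyclic (V + s1 *: v) (V + s2 *: v) (V + t1 *: w) (V + t2 *: w).
Proof.
move=> vw XZ pow.
pose m := (s1 + s2) * dot v v / 2; pose n := (t1 + t2) * dot w w / 2.
(* Cramer's solution of [dot z v = m], [dot z w = n]. *)
pose z : plane R := \row_i
  (if i == 0 then (m * w 0 1 - n * v 0 1) / cross v w
   else (n * v 0 0 - m * w 0 0) / cross v w).
have z0 : z 0 0 = (m * w 0 1 - n * v 0 1) / cross v w by rewrite mxE.
have z1 : z 0 1 = (n * v 0 0 - m * w 0 0) / cross v w by rewrite mxE.
have zv : dot z v = m.
  by rewrite /dot z0 z1; move: vw; rewrite /cross => vw; field.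
have zw : dot z w = n.
  by rewrite /dot z0 z1; move: vw; rewrite /cross => vw; field.
have dK u s : dot (V + z - (V + s *: u)) (V + z - (V + s *: u)) =
              dot z z - 2 * s * dot z u + s ^+ 2 * dot u u.
  by rewrite /dot !mxE; ring.
have d2 : dist (V + z) (V + s2 *: v) = dist (V + z) (V + s1 *: v).
  by rewrite !distE !dK zv /m; congr Num.sqrt; field.
have d3 : dist (V + z) (V + t1 *: w) = dist (V + z) (V + s1 *: v).
  rewrite !distE !dK zv zw /m /n; congr Num.sqrt; lra.
have d4 : dist (V + z) (V + t2 *: w) = dist (V + z) (V + s1 *: v).
  rewrite !distE !dK zv zw /m /n; congr Num.sqrt; lra.
exists (V + z), (dist (V + z) (V + s1 *: v)); split; last by split.
(* The radius is positive because the center cannot equal two distinct points. *)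
have [KX|KX] := eqVneq (V + z) (V + s1 *: v); last first.
  by rewrite distE sqrtr_gt0 dot_gt0.
by rewrite -d3 distE sqrtr_gt0 dot_gt0 // KX.
Qed.

(* [V] is the common point of the two lines [X Y] and [Z W], orthogonal to [v]
   and [w]; [dot (X - Z) w] is then [dot (X - V) w]. *)
Lemma concyclic_secants v w X Y Z W :
  cross v w != 0 -> X != Z ->
  dot (X - Y) v = 0 -> dot (Z - W) w = 0 ->
  dot v v * (dot (X - Z) w * dot (Y - Z) w) =
  dot w w * (dot (Z - X) v * dot (W - X) v) ->
  concyclic X Y Z W.
Proof.
move=> vw XZ XYv ZWw pow.
(* The quarter turn: [J v] and [J w] direct the lines [X Y] and [Z W]. *)
pose J u : plane R := \row_i (if i == 0 then - u 0 1 else u 0 0).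
have J0 u : (J u) 0 0 = - u 0 1 by rewrite mxE.
have J1 u : (J u) 0 1 = u 0 0 by rewrite mxE.
pose d := cross v w.
(* Since [dot (J v) w = d], this shift along [X Y] makes [dot (V - Z) w] vanish. On the other line
   [dot (J w) v = - d], whence the minus signs below. *)
pose V := X - (dot (X - Z) w / d) *: J v.
have VX : X = V + (dot (X - Z) w / d) *: J v by rewrite subrK.
have VY : Y = V + (dot (Y - Z) w / d) *: J v.
  apply/eqP; rewrite -subr_eq0; apply/eqP; apply: plane_eqP;
    rewrite /V !mxE /=; apply: (mulIf vw).
    transitivity (- w 0 1 * dot (X - Y) v); last by rewrite XYv mulr0 mul0r.
    by rewrite /d; move: vw; rewrite /cross /dot !mxE => vw; field.
  transitivity (w 0 0 * dot (X - Y) v); last by rewrite XYv mulr0 mul0r.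
  by rewrite /d; move: vw; rewrite /cross /dot !mxE => vw; field.
have VZ : Z = V + (- dot (Z - X) v / d) *: J w.
  apply: plane_eqP;
    by rewrite /V /d; move: vw; rewrite /cross /dot !mxE /= => vw; field.
have VW : W = V + (- dot (W - X) v / d) *: J w.
  apply/eqP; rewrite -subr_eq0; apply/eqP; apply: plane_eqP;
    rewrite /V !mxE /=; apply: (mulIf vw).
    transitivity (v 0 1 * dot (Z - W) w); last by rewrite ZWw mulr0 mul0r.
    by rewrite /d; move: vw; rewrite /cross /dot !mxE => vw; field.
  transitivity (- v 0 0 * dot (Z - W) w); last by rewrite ZWw mulr0 mul0r.
  by rewrite /d; move: vw; rewrite /cross /dot !mxE => vw; field.
have dJ u : dot (J u) (J u) = dot u u by rewrite /dot !J0 !J1; ring.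
have cJ : cross (J v) (J w) = cross v w by rewrite /cross !J0 !J1; ring.
have := @concyclic_secants_param V (J v) (J w) (dot (X - Z) w / d)
  (dot (Y - Z) w / d) (- dot (Z - X) v / d) (- dot (W - X) v / d).
rewrite -VX -VY -VZ -VW cJ; apply=> //.
rewrite !dJ.
transitivity (dot v v * (dot (X - Z) w * dot (Y - Z) w) / d ^+ 2).
  by field; exact: vw.
by rewrite pow; field; exact: vw.
Qed.

(** * Cevians in the basis of the vectors from [P] to [B] and [C] *)

(** Expressing [E - P] along each of the two lines and comparing coefficients gives
    [1 - p = - q * k] and [q * (1 + k) = 1]. *)
Lemma cevian_foot A B C P E k :
  0 < k -> cross (B - P) (C - P) != 0 ->
  A - P = (- k) *: (B - P + (C - P)) ->
  on_line B P E -> on_line C A E -> E - P = (- (k / (1 + k))) *: (B - P).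
Proof.
move=> k0 bc hA [p hp] [q hq].
have hE : E - P = (1 - p) *: (B - P).
  by rewrite hp; apply: plane_eqP; rewrite !mxE; ring.
have hE' : E - P = (1 - q) *: (C - P) + q *: (A - P).
  by rewrite hq; apply: plane_eqP; rewrite !mxE; ring.
have [|h1 h2] := @cross_free _ _ (1 - p + q * k) (q * k - (1 - q)) bc.
  transitivity ((1 - p) *: (B - P) -
      ((1 - q) *: (C - P) + q *: ((- k) *: (B - P + (C - P))))).
    by apply: plane_eqP; rewrite !mxE; ring.
  by rewrite -hA -hE' hE subrr.
rewrite hE; congr (_ *: _).
have k1 : 1 + k != 0 by rewrite lt0r_neq0 // addr_gt0.
have -> : k / (1 + k) = q * k; last by lra.
apply: (mulIf k1); rewrite divfK //.
have -> : q * k * (1 + k) = k * (q * k + q) by ring.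
by rewrite (_ : q * k + q = 1) ?mulr1 //; lra.
Qed.

(** Comparing the two barycentric expressions of [P] gives [b = c = t / 2] and [a = 1 - t], so [k]
    is [b / a]. *)
Lemma median_interior A B C P :
  triangle A B C -> in_segment A (midpoint B C) P -> inside_triangle A B C P ->
  exists2 k, 0 < k & A - P = (- k) *: (B - P + (C - P)).
Proof.
move=> /triangle_cross ABC [t [_ hP]] [a [b [c [[a0 b0 c0] [abc hP']]]]].
have [|h1 h2] := @cross_free _ _ (b - t / 2) (c - t / 2) ABC.
  transitivity (a *: A + b *: B + c *: C -
                ((1 - t) *: A + t *: midpoint B C)).
    have -> : a = 1 - b - c by lra.
    by apply: plane_eqP; rewrite !mxE; field.
  by rewrite -hP' -hP subrr.
have ea : a = 1 - t by lra.
have a1 : 1 - t != 0 by rewrite -ea lt0r_neq0.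
exists (b / a); first by rewrite divr_gt0.
have -> : b / a = t / 2 / (1 - t) by congr (_ / _); lra.
by rewrite hP; apply: plane_eqP; rewrite !mxE; field.
Qed.

Lemma dotBl P u X Y : dot (X - Y) u = dot (X - P) u - dot (Y - P) u.
Proof. by rewrite /dot !mxE; ring. Qed.

Lemma dotDr u v w : dot u (v + w) = dot u v + dot u w.
Proof. by rewrite /dot !mxE; ring. Qed.

Lemma dotDD v w : dot (v + w) (v + w) = dot v v + 2 * dot v w + dot w w.
Proof. by rewrite /dot !mxE; ring. Qed.

End Plane.

Theorem theorem3p6 (R : realType)
    (A B C D P E F O1 O2 O3 O4 O5 O6 : plane R)
    (hABC : triangle A B C)
    (hD : D = midpoint B C)
    (hPmedian : in_segment A D P)
    (hPinside : inside_triangle A B C P)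
    (hEline : on_line B P E) (hEside : in_segment C A E)
    (hFline : on_line C P F) (hFside : in_segment A B F)
    (hO1 : is_circumcenter P B D O1)
    (hO2 : is_circumcenter P D C O2)
    (hO3 : is_circumcenter P C E O3)
    (hO4 : is_circumcenter P E A O4)
    (hO5 : is_circumcenter P A F O5)
    (hO6 : is_circumcenter P F B O6) :
  concyclic O1 O2 O3 O6 /\ concyclic O3 O4 O5 O6.
Proof.
have [k k0 hA] : exists2 k, 0 < k & A - P = (- k) *: (B - P + (C - P)).
  by apply: median_interior hPinside => //; rewrite -hD.
have bc : cross (B - P) (C - P) != 0.
  apply: contraNneq (triangle_cross hABC) => bc0.
  have hBA : B - A = B - P - (A - P) by apply: plane_eqP; rewrite !mxE; ring.
  have hCA : C - A = C - P - (A - P) by apply: plane_eqP; rewrite !mxE; ring.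
  have -> : cross (B - A) (C - A) = (1 + 2 * k) * cross (B - P) (C - P).
    by rewrite hBA hCA hA /cross !mxE; ring.
  by rewrite bc0 mulr0.
have cb : cross (C - P) (B - P) != 0.
  rewrite (_ : cross _ _ = - cross (B - P) (C - P)) ?oppr_eq0 //.
  by rewrite /cross; ring.
have hE := cevian_foot k0 bc hA hEline (in_segment_on_line hEside).
(* [A - P] is symmetric in [B] and [C], so exchanging them yields the same ratio for [F]. *)
have hF : F - P = (- (k / (1 + k))) *: (C - P).
  apply: (@cevian_foot _ A C B) => //.
    by rewrite (addrC (C - P)).
  exact/on_line_sym/in_segment_on_line.
have e0 : 0 < k / (1 + k) by rewrite divr_gt0 // addr_gt0.
move: hE hF e0; set e := k / (1 + k) => hE hF e0.
have hDP : D - P = 2^-1 *: (B - P + (C - P)).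
  by rewrite hD; apply: plane_eqP; rewrite !mxE; field.
have hB : B - P = 1 *: (B - P) by rewrite scale1r.
have hC : C - P = 1 *: (C - P) by rewrite scale1r.
have n1 : (1 : R) != 0 by exact: oner_neq0.
have nh : (2^-1 : R) != 0 by rewrite invr_eq0 pnatr_eq0.
have nk : - k != 0 by rewrite oppr_eq0 lt0r_neq0.
have ne : - e != 0 by rewrite oppr_eq0 lt0r_neq0.
have b0 : 0 < dot (B - P) (B - P).
  rewrite dot_gt0 //; apply: contraNneq bc => ->.
  by rewrite /cross !mxE; apply/eqP; ring.
have [x1 y1] := circumcenter_dot hO1 n1 hB nh hDP.
have [x2 y2] := circumcenter_dot hO2 nh hDP n1 hC.
have [x3 y3] := circumcenter_dot hO3 n1 hC ne hE.
have [x4 y4] := circumcenter_dot hO4 ne hE nk hA.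
have [x5 y5] := circumcenter_dot hO5 nk hA ne hF.
have [x6 y6] := circumcenter_dot hO6 ne hF n1 hB.
(* Triangles with vertex [D] or [A] give the product with the sum of the basis vectors; expanding it
   isolates the missing coordinate of the center. *)
rewrite !(dotDD (B - P)) !(dotDr _ (B - P)) in y1 x2 y4 x5.
(* Their products with [B - P] have opposite signs. *)
have O36 : O3 != O6.
  apply/eqP => O36; move: y3; rewrite O36 y6 => h.
  have : 0 < e * dot (B - P) (B - P) by rewrite mulr_gt0.
  lra.
have v3 : dot (O3 - P) (B - P) = - e * dot (B - P) (B - P) / 2 by lra.
have w3 : dot (O3 - P) (C - P) = dot (C - P) (C - P) / 2 by lra.
have v6 : dot (O6 - P) (B - P) = dot (B - P) (B - P) / 2 by lra.
have w6 : dot (O6 - P) (C - P) = - e * dot (C - P) (C - P) / 2 by lra.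
set m := dot (B - P) (C - P) in y1 x2 y4 x5.
(* [O6], [O1] lie on the perpendicular bisector of [PB], and [O3], [O2] on that of [PC]. *)
have [||||O [r [r0 []]]] := @concyclic_secants _ _ _ O6 O1 O3 O2 bc.
- by rewrite eq_sym.
- by rewrite (dotBl P); lra.
- by rewrite (dotBl P); lra.
(* With b, c the basis vectors, both sides equal (1 + e) |b|^2 |c|^2 |b - c|^2 / 8. *)
- have w1 : dot (O1 - P) (C - P) =
      (2 * m + dot (C - P) (C - P) - dot (B - P) (B - P)) / 4 by lra.
  have v2 : dot (O2 - P) (B - P) =
      (2 * m + dot (B - P) (B - P) - dot (C - P) (C - P)) / 4 by lra.
  rewrite !(dotBl P _ _ O3) !(dotBl P _ _ O6).
  by rewrite v2 v3 v6 w1 w3 w6; field.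
(* Now the lines are the perpendicular bisectors of [PE], through [O3] and [O4], and of [PF],
   through [O6] and [O5]. *)
have [|||O' [r' [r0' []]]] := @concyclic_secants _ _ _ O3 O4 O6 O5 bc O36.
- by rewrite (dotBl P); lra.
- by rewrite (dotBl P); lra.
(* Both second factors equal (e |b|^2 + e |c|^2 - k |b + c|^2) / 2, which is symmetric in b and
   c. *)
- have w4 : dot (O4 - P) (C - P) = e * dot (B - P) (B - P) / 2 -
      k * (dot (B - P) (B - P) + 2 * m + dot (C - P) (C - P)) / 2 by lra.
  have v5 : dot (O5 - P) (B - P) = e * dot (C - P) (C - P) / 2 -
      k * (dot (B - P) (B - P) + 2 * m + dot (C - P) (C - P)) / 2 by lra.
  rewrite !(dotBl P _ _ O3) !(dotBl P _ _ O6).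
  by rewrite v3 v5 v6 w3 w4 w6; field.
by move=> *; split; [exists O, r | exists O', r'].
Qed.
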